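(* For every real number $M>0$, the set $$\mathcal{B}_M=\{n\ge 2:\mathcal{C}(\mathbb{Z}/n\mathbb{Z})\ge M\varphi(n)\}$$ of integers has positive lower asymptotic density. In particular, it is infinite.
   Context: For an element $x$ of a finite group $G$, $\operatorname{ord}(x)$ denotes its order (for $\mathbb{Z}/n\mathbb{Z}$, the additive order). A nonempty subset $S\subseteq G$ is called a Chowla set if $\operatorname{ord}(x)>|S|$ for every $x\in S$. Define $\mathcal{C}(G)=\max\{|S|:S\subseteq G\text{ is a Chowla set}\}$. $\varphi$ is Euler's totient function. The lower asymptotic density of a set $\mathcal{B}\subseteq\mathbb{N}$ is $\underline{d}(\mathcal{B})=\liminf_{x\to\infty}\frac1x|\{n\le x:n\in\mathcal{B}\}|$. *)

(* Defs.v *)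
From HB Require Import structures.
From mathcomp Require Import all_boot all_order all_algebra all_fingroup.
From mathcomp Require Import finmap.
From mathcomp Require Import all_classical all_reals all_analysis.

Set Implicit Arguments.
Unset Strict Implicit.
Unset Printing Implicit Defensive.

Import Order.TTheory GRing.Theory Num.Theory.
Import numFieldNormedType.Exports.

Local Open Scope classical_set_scope.
Local Open Scope ring_scope.

Definition chowla_set (gT : finGroupType) (S : {set gT}) : bool :=
  (S != finset.set0) && [forall x in S, (#|S| < #[x]%g)%N].

(* The maximum is 0 when there is no Chowla set, that is, when gT is trivial. *)
Definition chowla_number (gT : finGroupType) : nat :=
  (\max_(S : {set gT} | chowla_set S) #|S|)%N.

Definition lower_density (R : realType) (B : set nat) : \bar R :=
  limf_einf
    (fun x : R => (x^-1 * #|` fset_set [set n | B n /\ n%:R <= x]|%:R)%:E)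
    +oo.

(* 'Z_n is Z/nZ only for n >= 2, whence the condition on n comes first;
   #[x] in 'Z_n is the additive order. *)
Definition chowla_large (R : realType) (M : R) : set nat :=
  [set n | (2 <= n)%N /\ M * (totient n)%:R <= (chowla_number 'Z_n)%:R].

(* Main.v *)
Require Import Defs.
From mathcomp Require Import all_boot all_order all_algebra all_fingroup.
From mathcomp Require Import cyclic.
From mathcomp Require Import ring lra finmap.
From mathcomp Require Import all_classical all_reals all_analysis.

(** Everything rests on the inequality phi(ab) <= a phi(b), used in the form
    phi(n/e) >= phi(n)/e for e dividing n.  In Z/nZ there are phi(n/e)
    elements of order n/e; so, if 1, ..., L all divide n, adding up over
    e <= L gives
      phi(n) (1 + 1/2 + ... + 1/L)  <=  #{x in Z/nZ : ord(x) >= n/L}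
    ([totient_harmonic_le]).  Since the harmonic series diverges, this bound
    serves twice.

    Let m >= M be a positive integer.  Fix K with 1 + ... + 1/K >= m: at least
    m phi(n) elements have order at least n/K.  Then fix N >= K such that
    1 + ... + 1/N > mK: as the right-hand side above is at most n, this forces
    m phi(n) < n/K.  Hence, among the elements of order at least n/K, any
    m phi(n) form a Chowla set, and the Chowla number of Z/nZ is at least
    m phi(n) >= M phi(n).

    All that was required of n is that 1, ..., N divide it, which holds for
    every positive multiple of N! ([chowla_large_multiples]).  A set that
    contains all positive multiples of a fixed integer has positive lower
    density ([lower_density_ge_multiples]). *)

Import Order.TTheory GRing.Theory Num.Theory.
Local Open Scope ring_scope.

(** An integer below ab that is coprime to ab is coprime to b, and coprimality
    to b is b-periodic: each of the a intervals of length b contains phi(b)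
    such integers. *)
Lemma totient_mul_le (a b : nat) : (totient (a * b) <= a * totient b)%N.
Proof.
have count_le c : (\sum_(0 <= d < c * b) coprime b d <= c * totient b)%N.
  elim: c => [|c IHc]; first by rewrite !mul0n big_geq.
  rewrite !mulSnr (big_cat_nat (n := c * b)) ?leq_addr //= leq_add //.
  rewrite -{1}[(c * b)%N]add0n big_addn addKn totient_count_coprime.
  by apply: leq_sum => d _; rewrite /coprime addnC gcdnMDl.
apply: leq_trans (count_le a); rewrite totient_count_coprime.
by apply: leq_sum => d _; rewrite coprimeMl; case: coprime.
Qed.

(** The power a ^+ e generates a cyclic group with phi(#[a] / e) generators, each
    of order #[a] / e; these orders differ for different e, so the sets of
    generators are disjoint.  The condition on the order of x is written
    without division. *)
Lemma sum_totient_le_card_order (gT : finGroupType) (a : gT) (K : nat) :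
    (forall i, (i < K)%N -> (i.+1 %| #[a]%g)%N) ->
  (\sum_(i < K) totient (#[a]%g %/ i.+1)
     <= #|[set x : gT | #[a]%g <= K * #[x]%g]%N|)%N.
Proof.
move=> dvdK.
have order_pow (i : 'I_K) : #[a ^+ i.+1]%g = (#[a]%g %/ i.+1)%N.
  exact/orderXdiv/dvdK.
pose F (i : 'I_K) := [set x | generator <[a ^+ i.+1]>%g x].
have order_gen (i : 'I_K) x : x \in F i -> (i.+1 * #[x]%g = #[a]%g)%N.
  rewrite inE => /generator_order <-.
  by rewrite order_pow mulnC divnK // dvdK.
have disjF i j : i != j -> [disjoint F i & F j].
  move=> neq_ij; apply/pred0P => x /=; apply/negbTE/negP.
  move=> /andP[/order_gen ox /order_gen]; rewrite -ox => /eqP.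
  rewrite eqn_pmul2r ?order_gt0 // eqSS eq_sym => /eqP/val_inj eq_ij.
  by rewrite eq_ij eqxx in neq_ij.
have -> : (\sum_(i < K) totient (#[a]%g %/ i.+1))%N = #|\bigcup_i F i|.
  rewrite -sum1_card (partition_disjoint_bigcup _ _ disjF).
  by apply: eq_bigr => i _; rewrite -order_pow totient_gen sum1_card.
apply/subset_leq_card/fintype.subsetP => x /finset.bigcupP[i _ /order_gen ox].
by rewrite inE -ox leq_mul2r ltn_ord orbT.
Qed.

(** For small K this produces many elements of large order; for large K,
    bounding the right-hand side by the order of the group, it shows that
    phi(n)/n is small. *)
Lemma totient_harmonic_le (R : numFieldType) (gT : finGroupType) (a : gT)
    (K : nat) :
    (forall i, (i < K)%N -> (i.+1 %| #[a]%g)%N) ->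
  (totient #[a]%g)%:R * series harmonic K
    <= #|[set x : gT | #[a]%g <= K * #[x]%g]%N|%:R :> R.
Proof.
move=> dvdK.
apply: le_trans (_ : (\sum_(i < K) totient (#[a]%g %/ i.+1))%:R <= _); last first.
  by rewrite ler_nat sum_totient_le_card_order.
rewrite /series /= big_mkord natr_sum mulr_sumr ler_sum // => i _.
rewrite ler_pdivrMr ?ltr0n // -natrM ler_nat mulnC.
by rewrite -{1}(divnK (dvdK i (ltn_ord i))) mulnC totient_mul_le.
Qed.

(** A Chowla set need not contain all the elements of large order: any s of them
    will do, as long as s stays below their orders. *)
Lemma chowla_number_ge (gT : finGroupType) (A : {set gT}) (s : nat) :
    (0 < s <= #|A|)%N -> {in A, forall x, (s < #[x]%g)%N} ->
  (s <= chowla_number gT)%N.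
Proof.
move=> /andP[s_gt0 /card_geqP[t [uniq_t size_t tA]]] ordA.
have card_t : #|[set x in t]| = s by rewrite cardsE (card_uniqP _).
rewrite -card_t /chowla_number leq_bigmax_cond // /chowla_set card_t.
rewrite -card_gt0 card_t s_gt0; apply/forall_inP => x.
by rewrite inE => /tA/ordA.
Qed.

Lemma harmonic_large (R : realType) (A : R) :
  exists K0, forall K, (K0 <= K)%N -> A <= series harmonic K.
Proof.
have incr : nondecreasing_seq (series (@harmonic R)).
  by apply: nondecreasing_series => n _ _; exact: harmonic_ge0.
have /cvgryPge/(_ A)[K0 _ HK0] := nondecreasing_dvgn_lt incr (@dvg_harmonic R).
by exists K0.
Qed.

(** The same modulus N! makes the elements of order at least n/K numerous (its
    multiples are divisible by 1, ..., K) and phi(n)/n small. *)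
Lemma chowla_large_multiples (R : realType) (M : R) :
  exists2 Q, (0 < Q)%N & forall n, (Q %| n)%N -> (0 < n)%N -> chowla_large M n.
Proof.
pose m := (Num.truncn `|M|).+1.
have leMm : M <= m%:R.
  by rewrite (le_trans (ler_norm M)) // ltW // truncnS_gt.
have [K HK] := harmonic_large R m%:R.
have [N0 HN0] := harmonic_large R (m * K).+1%:R.
(* 2 <= N, so that positive multiples of N! are at least 2, where 'Z_n is Z/nZ. *)
pose N := maxn 2 (maxn K N0).
have [N_ge2 leKN leN0N] : [/\ 2 <= N, K <= N & N0 <= N]%N.
  by rewrite !leq_max !leqnn !orbT.
exists N`!; first exact: fact_gt0.
move=> n dvdQn n_gt0.
have dvdN i : (i < N)%N -> (i.+1 %| n)%N.
  by move=> ltiN; apply: dvdn_trans dvdQn; rewrite dvdn_fact.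
have n_ge2 : (1 < n)%N by rewrite dvdn_leq // dvdN.
have order1 : #[(1%R : 'Z_n)]%g = n by rewrite order_Zp1 Zp_cast.
have phi_gt0 : (0 < totient n)%N by rewrite totient_gt0.
have card_ge L : (L <= N)%N -> (totient n)%:R * series harmonic L
    <= #|[set x : 'Z_n | n <= L * #[x]%g]%N|%:R :> R.
  move=> leLN; have := @totient_harmonic_le R _ (1%R : 'Z_n) L.
  by rewrite order1; apply => i ltiL; apply/dvdN/(leq_trans ltiL).
have small : (m * totient n * K < n)%N.
  (* The harmonic bound with L = N, whose right-hand side is at most n. *)
  have : (totient n)%:R * (m * K).+1%:R <= n%:R :> R.
    apply: le_trans (le_trans (card_ge N (leqnn _)) _).
      by rewrite ler_wpM2l ?HN0.
    by rewrite ler_nat (leq_trans (max_card _)) // card_ord Zp_cast.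
  rewrite -natrM ler_nat; apply: leq_trans.
  by rewrite mulnAC mulnC ltn_pmul2l.
split=> //; apply: le_trans (_ : (m * totient n)%:R <= _).
  by rewrite natrM ler_wpM2r.
rewrite ler_nat.
apply: (@chowla_number_ge _ [set x : 'Z_n | n <= K * #[x]%g]%N).
  rewrite muln_gt0 phi_gt0 /= -(ler_nat R).
  apply: le_trans (card_ge K leKN).
  by rewrite natrM mulrC ler_wpM2l ?HK.
move=> x; rewrite inE => /(leq_trans small).
by rewrite mulnC ltn_mul2l => /andP[].
Qed.

Local Open Scope classical_set_scope.
Local Open Scope ring_scope.

Lemma inj_succ_mul (Q : nat) :
  (0 < Q)%N -> {in [set: nat] &, injective (fun i => i.+1 * Q)%N}.
Proof. by move=> Q_gt0 i j _ _ /eqP; rewrite eqn_pmul2r // => /eqP[]. Qed.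

(** Up to x there are floor(x / Q) positive multiples of Q.  The factor 2 absorbs
    the rounding: x / Q - 1 >= x / (2 Q) as soon as x >= 2 Q. *)
Lemma lower_density_ge_multiples (R : realType) (B : set nat) (Q : nat) :
    (0 < Q)%N -> (forall k, B (k.+1 * Q)%N) ->
  ((2 * Q%:R)^-1%:E <= lower_density R B)%E.
Proof.
move=> Q_gt0 QB; have QR_gt0 : 0 < Q%:R :> R by rewrite ltr0n.
rewrite /lower_density limf_einfE.
apply: le_ereal_sup_tmp.
exists (ereal_inf [set (x^-1 * #|` fset_set [set n | B n /\ n%:R <= x]|%:R)%:E
                  | x in [set x : R | 2 * Q%:R <= x]]).
  by exists [set x : R | 2 * Q%:R <= x] => //; exact: nbhs_pinfty_ge.
apply/ereal_infP => _ [x /= x_ge <-]; rewrite lee_fin.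
have x_gt0 : 0 < x by apply: lt_le_trans x_ge; rewrite mulr_gt0.
pose k := Num.truncn (x / Q%:R).
pose Bx := [set n | B n /\ n%:R <= x]; rewrite -/Bx.
have fin : finite_set Bx.
  apply: (sub_finite_set _ (finite_II (Num.truncn x).+1)) => n [_ nx] /=.
  by rewrite ltnS truncn_ge_nat // ltW.
have lekc : (k <= #|` fset_set Bx|)%N.
  apply: leq_card_fset_set => //.
  have injf : {in `I_k &, injective (fun i => i.+1 * Q)%N}.
    by move=> i j _ _; apply: inj_succ_mul; rewrite ?inE.
  rewrite -(card_le_eql (inj_card_eq injf)); apply: subset_card_le.
  move=> _ [i /= ltik <-]; split; first exact: QB.
  rewrite natrM -ler_pdivlMr // -truncn_ge_nat //.
  by rewrite divr_ge0 // ltW.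
rewrite ler_pdivlMl //; apply: le_trans (_ : k%:R <= _); last by rewrite ler_nat.
have : x / Q%:R < k.+1%:R by rewrite truncnS_gt.
have : 1 <= x / (2 * Q%:R) by rewrite ler_pdivlMr ?mul1r // mulr_gt0.
have -> : x / Q%:R = x / (2 * Q%:R) *+ 2.
  by field; rewrite lt0r_neq0.
rewrite mulr2n -natr1; lra.
Qed.

Theorem theorem2p11 (R : realType) (M : R) (hM : 0 < M) :
  (0 < lower_density R (chowla_large M))%E /\ infinite_set (chowla_large M).
Proof.
have [Q Q_gt0 QB] := chowla_large_multiples R M.
have mulB k : chowla_large M (k.+1 * Q)%N by apply: QB; rewrite ?dvdn_mull ?muln_gt0.
split.
  apply: lt_le_trans (lower_density_ge_multiples R _ _ Q_gt0 mulB).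
  by rewrite lte_fin invr_gt0 mulr_gt0 ?ltr0n.
apply: (@sub_infinite_set _ ((fun i => i.+1 * Q)%N @` [set: nat])).
  by move=> _ [i _ <-].
by rewrite (eq_finite_set (inj_card_eq (inj_succ_mul _ Q_gt0))); exact: infinite_nat.
Qed.
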